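(* The family $\{\phi_\alpha\}_{\alpha\ge1}$ (indexed by $\alpha\in[1,\infty)$) given by $$\phi_\alpha(x)=\sqrt{\frac{2}{\pi}}\,\frac{\alpha}{\alpha^2+x^2},\qquad x\in\mathbb{R},$$ is a regular family of interpolators.
   Context: Fourier transform: $\hat g(\xi)=(2\pi)^{-1/2}\int_{\mathbb{R}}g(x)e^{-ix\xi}\,dx$ for $g\in L^1(\mathbb{R})$. Conditions (A1)-(A3) on a real-valued function $\phi$ on $\mathbb{R}$: (A1) $\phi,\hat\phi\in L^1(\mathbb{R})$; (A2) $\hat\phi(\xi)\ge 0$ for all $\xi\in\mathbb{R}$, and there is $\delta>0$ with $\hat\phi(\xi)\ge\delta$ on $[-\pi,\pi]$; (A3) with $M_j=\sup_{|\xi|\le\pi}\hat\phi(\xi+2\pi j)$, $\{M_j\}\in l^1(\mathbb{Z})$. Let $\Lambda\subset(0,\infty)$ be an unbounded set (discrete or continuous). A family $\{\phi_\alpha\}_{\alpha\in\Lambda}$ of real-valued functions is a regular family of interpolators if: (H1) each $\phi_\alpha$ satisfies (A1)-(A3); (H2) there is $C$ independent of $\alpha$ with $\sum_{j\ne0}M_j(\alpha)\le C m_\alpha$ for all $\alpha\in\Lambda$, where $M_j(\alpha)=\sup_{|\xi|\le\pi}\hat\phi_\alpha(\xi+2\pi j)$ and $m_\alpha=\inf_{|\xi|\le\pi}\hat\phi_\alpha(\xi)$; (H3) for almost every $|\xi|\le\pi$, $\lim_{\alpha\to\infty} m_\alpha/\hat\phi_\alpha(\xi)=0$. *)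

(* Defs.v *)
From HB Require Import structures.
From mathcomp Require Import all_boot all_order all_algebra.
From mathcomp Require Import all_classical all_reals all_analysis.
From mathcomp Require Import complex.

Set Implicit Arguments.
Unset Strict Implicit.
Unset Printing Implicit Defensive.

Import Order.TTheory GRing.Theory Num.Theory.
Import numFieldNormedType.Exports.

Local Open Scope classical_set_scope.
Local Open Scope ring_scope.
Local Open Scope complex_scope.

Definition expi {R : realType} (t : R) : R[i] := cos t +i* sin t.

Definition complex_integrable {R : realType} (g : R -> R[i]) : Prop :=
  lebesgue_measure.-integrable setT (fun x => (complex.Re (g x))%:E) /\
  lebesgue_measure.-integrable setT (fun x => (complex.Im (g x))%:E).

Definition complex_integral {R : realType} (g : R -> R[i]) : R[i] :=
  Rintegral lebesgue_measure setT (fun x => complex.Re (g x)) +i*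
  Rintegral lebesgue_measure setT (fun x => complex.Im (g x)).

(* Only meaningful when [complex_integrable g]. *)
Definition fourier {R : realType} (g : R -> R[i]) (xi : R) : R[i] :=
  ((Num.sqrt (2 * pi))^-1)%:C *
  complex_integral (fun x => g x * expi (- (x * xi))).

Definition fourier_real {R : realType} (phi : R -> R) : R -> R[i] :=
  fourier (fun x => (phi x)%:C).

(* Suprema and infima are taken of the real part; where they are used, the
   Fourier transform is required to be nonnegative, hence real.  The supremum
   is extended-real so that an unbounded transform gives +oo. *)
Definition Msup {R : realType} (phi : R -> R) (j : int) : \bar R :=
  ereal_sup [set (complex.Re (fourier_real phi (xi + 2 * pi * j%:~R)))%:E
            | xi in [set xi : R | `|xi| <= pi]].

Definition minf {R : realType} (phi : R -> R) : R :=
  inf [set complex.Re (fourier_real phi xi)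
      | xi in [set xi : R | `|xi| <= pi]].

Definition condA1 {R : realType} (phi : R -> R) : Prop :=
  lebesgue_measure.-integrable setT (fun x => (phi x)%:E) /\
  complex_integrable (fourier_real phi).

(* The order on R[i] makes [0 <= z] say that z is real and nonnegative. *)
Definition condA2 {R : realType} (phi : R -> R) : Prop :=
  (forall xi : R, 0 <= fourier_real phi xi) /\
  (exists2 delta : R, 0 < delta &
     forall xi : R, `|xi| <= pi -> delta%:C <= fourier_real phi xi).

Definition condA3 {R : realType} (phi : R -> R) : Prop :=
  summable [set: int] (Msup phi).

Record regular_family_of_interpolators {R : realType}
    (Lambda : set R) (phi : R -> R -> R) : Prop := {
  index_pos : forall alpha, Lambda alpha -> 0 < alpha ;
  index_unbounded : ~ has_ubound Lambda ;
  regular_H1 : forall alpha, Lambda alpha ->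
    [/\ condA1 (phi alpha), condA2 (phi alpha) & condA3 (phi alpha)] ;
  regular_H2 : exists C : R, forall alpha, Lambda alpha ->
    (\esum_(j in [set j : int | (j != 0)%R]) Msup (phi alpha) j
      <= (C * minf (phi alpha))%:E)%E ;
  regular_H3 : {ae lebesgue_measure, forall xi : R, `|xi| <= pi ->
    (fun alpha => minf (phi alpha) / complex.Re (fourier_real (phi alpha) xi))
      @ within Lambda (pinfty_nbhs R) --> (0 : R)}
}.

(* Main.v *)
(* Idea.  For a > 0 the transform of phi_a is xi |-> exp (- a |xi|), after which
   (A1)-(A3) and (H1)-(H3) are estimates on geometric series.  To compute it,
   write a / (a^2 + x^2) as the Laplace integral of exp (- a y) cos (x y) over
   y >= 0 and damp the cosine integral by exp (- x / k), so that Tonelli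
   applies.  Integrating first in x turns the damped integral of
   cos (s x) a / (a^2 + x^2) into that of exp (- a y) against half the
   derivative of atan (k (y - s)) + atan (k (y + s)); integrating by parts
   moves the derivative to the exponential, and as k tends to infinity the sum
   of arctangents tends to pi times the indicator of y > s (s >= 0). *)
Require Import Defs.
From mathcomp Require Import all_boot all_order all_algebra.
From mathcomp Require Import all_classical all_reals all_analysis.
From mathcomp Require Import measurable_realfun ring lra complex.
Import Order.TTheory GRing.Theory Num.Theory.
Import numFieldNormedType.Exports.
Local Open Scope classical_set_scope.
Local Open Scope ring_scope.

Section PoissonKernel.
Set Implicit Arguments.
Unset Strict Implicit.
Context {R : realType}.
Local Notation mu := (@lebesgue_measure R).
Local Notation Rp := ([set` `[(0:R), +oo[]).

(** * Calculus on half-lines: integration up to infinity and basic derivatives *)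

(** Nonnegativity of [f] lets the integral be computed in the extended reals from the limit of [F]
    alone; integrability is afterwards read off from the finite value, by [ge0_integrable]. *)
Lemma FTCy (f F : R -> R) (r l : R) :
  (forall x, r <= x -> 0 <= f x) -> continuous f ->
  (forall x : R, is_derive x 1 F (f x)) -> F x @[x --> +oo] --> l ->
  (\int[mu]_(x in `[r, +oo[) (f x)%:E = (l - F r)%:E)%E.
Proof.
move=> f0 cf dF Fl.
rewrite (@ge0_continuous_FTC2y R f F r l)//.
- exact: continuous_subspaceT.
- apply: cvg_at_right_filter; apply: differentiable_continuous.
  exact/derivable1_diffP.
- by move=> x _; rewrite derive1E derive_val.
Qed.

Lemma cvgy_mul0 (f g : R -> R) (M : R) : f x @[x --> +oo] --> 0 ->
  (forall x, `|g x| <= M) -> f x * g x @[x --> +oo] --> 0.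
Proof.
move=> f0 gM.
apply/norm_cvg0P.
apply: (@squeeze_cvgr _ _ _ _ (cst 0) (fun x => `|f x| * M)).
- apply: nearW => x /=; rewrite normr_ge0/= normrM.
  by rewrite ler_wpM2l.
- exact: cvg_cst.
- rewrite -[X in _ --> X](mul0r M) -[X in X * M](normr0 R).
  apply: cvgMl; exact: cvg_norm.
Qed.

Lemma cvgy_expRN (a : R) : 0 < a -> expR (- (a * x)) @[x --> +oo] --> 0.
Proof.
move=> a0.
apply: (@cvg_comp _ _ _ (fun x => a * x) (fun x => expR (- x)) _ _ _ _ (@cvgr_expR R)).
by apply: gt0_cvgMry => //; exact: cvg_id.
Qed.

Lemma is_derive1_eq (f : R -> R) (x a b : R) :
  is_derive x 1 f a -> a = b -> is_derive x 1 f b.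
Proof. by move=> + <-. Qed.

Lemma is_derive1M (f g : R -> R) (x a b : R) :
  is_derive x 1 f a -> is_derive x 1 g b ->
  is_derive x 1 (fun y : R => f y * g y) (a * g x + f x * b).
Proof.
move=> df dg; apply: is_derive1_eq (is_deriveM df dg) _.
by rewrite /GRing.scale/=; ring.
Qed.

Lemma is_derive1_affine (a b x : R) : is_derive x 1 (fun y : R => a * y + b) a.
Proof.
have := is_deriveD (is_deriveZ a (is_derive_id x (1 : R))) (is_derive_cst b x 1).
by move/is_derive1_eq; apply; rewrite addr0 /GRing.scale/= mulr1.
Qed.

Lemma is_derive1_linear (a x : R) : is_derive x 1 (fun y : R => a * y) a.
Proof.
have := is_derive1_affine a 0 x.
by rewrite (_ : (fun y => a * y + 0) = ( *%R a))//; apply/funext => y; rewrite addr0.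
Qed.

Lemma is_derive1_expRN (a x : R) :
  is_derive x 1 (fun y : R => expR (- (a * y))) (- a * expR (- (a * x))).
Proof.
have := is_derive1_comp (is_derive_expR _) (is_derive1_linear (- a) x).
rewrite (_ : expR \o _ = fun y => expR (- (a * y))); last first.
  by apply/funext => y /=; rewrite mulNr.
by move/is_derive1_eq; apply; rewrite mulNr mulrC.
Qed.

Lemma continuous_expRN (a : R) : continuous (fun x : R => expR (- (a * x))).
Proof.
move=> x; apply: (cvg_comp (fun x => - (a * x)) expR _ (@continuous_expR R _)).
by apply: cvgN; apply: cvgMr; exact: cvg_id.
Qed.

Lemma continuous_cos_mul (s : R) : continuous (fun x : R => cos (s * x)).
Proof.
move=> x; apply: (cvg_comp ( *%R s) cos _ (@continuous_cos R _)).
by apply: cvgMr; exact: cvg_id.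
Qed.

(** * Laplace integrals of cosines *)

(** One integrand for both orders of integration in the double integral: integrating in y uses one
    cosine ([c' = 0]), integrating in x uses two of weight 1/2. The summand 1 keeps it nonnegative
    as long as [|c| + |c'| <= 1]. *)
Definition expR_cos (a b b' c c' x : R) :=
  expR (- (a * x)) * (1 + c * cos (b * x) + c' * cos (b' * x)).

Lemma continuous_expR_cos (a b b' c c' : R) : continuous (expR_cos a b b' c c').
Proof.
move=> x; apply: cvgM; first exact: continuous_expRN.
have h (r s : R) : r * cos (s * y) @[y --> x] --> r * cos (s * x).
  by apply: cvgMr; exact: continuous_cos_mul.
by apply: cvgD => //; apply: cvgD => //; exact: cvg_cst.
Qed.

Lemma expR_cos_ge0 (a b b' c c' x : R) : `|c| + `|c'| <= 1 ->
  0 <= expR_cos a b b' c c' x.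
Proof.
move=> cc1; rewrite mulr_ge0 ?expR_ge0//.
have h (r s : R) : `|r * cos s| <= `|r| by rewrite normrM ler_piMr// cos_max.
have := h c (b * x); have := h c' (b' * x).
move: (c * _) (c' * _) => u v.
have := ler_norm (- u); have := ler_norm (- v); rewrite !normrN; lra.
Qed.

Lemma integral_expR_cos (a b b' c c' : R) : 0 < a -> `|c| + `|c'| <= 1 ->
  (\int[mu]_(x in Rp) (expR_cos a b b' c c' x)%:E =
  (a^-1 + c * (a / (a ^+ 2 + b ^+ 2)) + c' * (a / (a ^+ 2 + b' ^+ 2)))%:E)%E.
Proof.
move=> a0 cc1.
(* [S d] solves S' = cos (d y) + a S, so exp (- a y) S is a bounded antiderivative of exp (- a y)
   cos (d y) on the half-line. *)
pose S (d y : R) := (d * sin (d * y) - a * cos (d * y)) / (a ^+ 2 + d ^+ 2).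
pose F (y : R) := expR (- (a * y)) * (- a^-1 + (c * S b y + c' * S b' y)).
have Q0 d : a ^+ 2 + d ^+ 2 != 0.
  by rewrite gt_eqF// ltr_pwDl ?exprn_gt0// sqr_ge0.
have dS (d y : R) : is_derive y 1 (S d) (cos (d * y) + a * S d y).
  have ds := is_derive1_comp (is_derive_sin _) (is_derive1_linear d y).
  have dc := is_derive1_comp (is_derive_cos _) (is_derive1_linear d y).
  have := is_deriveZ (a ^+ 2 + d ^+ 2)^-1
    (is_deriveB (is_deriveZ d ds) (is_deriveZ a dc)).
  rewrite (_ : _ \*: _ = S d); last first.
    by apply/funext => z; rewrite /S /GRing.scale/= mulrC.
  move/is_derive1_eq; apply; rewrite /S /GRing.scale/=.
  have := Q0 d; move: (sin _) (cos _) => s t Qd; field.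
  exact: Qd.
have bS (d y : R) : `|S d y| <= (`|d| + a) / (a ^+ 2 + d ^+ 2).
  have Q1 : 0 < a ^+ 2 + d ^+ 2 by rewrite ltr_pwDl ?exprn_gt0// sqr_ge0.
  rewrite /S normrM (gtr0_norm (x := _^-1)) ?invr_gt0// ler_pM2r ?invr_gt0//.
  rewrite (le_trans (ler_normB _ _))// !normrM (gtr0_norm a0) lerD//.
  - by rewrite ler_piMr// sin_max.
  - by rewrite ler_piMr ?cos_max// ltW.
have dF (x : R) : is_derive x 1 F (expR_cos a b b' c c' x).
  have := is_derive1M (is_derive1_expRN a x)
    (is_deriveD (is_derive_cst (- a^-1) x 1)
      (is_deriveD (is_deriveZ c (dS b x)) (is_deriveZ c' (dS b' x)))).
  move/is_derive1_eq; apply.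
  rewrite /expR_cos !fctE /= /GRing.scale/=; field.
  by rewrite gt_eqF.
have Fy : F x @[x --> +oo] --> 0.
  pose K (d : R) := (`|d| + a) / (a ^+ 2 + d ^+ 2).
  apply: (@cvgy_mul0 _ _ (a^-1 + (`|c| * K b + `|c'| * K b'))).
    exact: cvgy_expRN.
  move=> x; rewrite (le_trans (ler_normD _ _))// normrN gtr0_norm ?invr_gt0// lerD2l.
  by rewrite (le_trans (ler_normD _ _))// lerD// normrM ler_wpM2l.
rewrite (FTCy _ _ dF Fy).
- rewrite /F /S !mulr0 oppr0 expR0 sin0 cos0; congr EFin; field.
  by rewrite !Q0 gt_eqF.
- by move=> x _; exact: expR_cos_ge0.
- exact: continuous_expR_cos.
Qed.

(** * Integrability, Tonelli on the quadrant, and scaled Laplace integrals *)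

Lemma ge0_integrable (D : set R) (f : R -> R) (r : R) : measurable D ->
  measurable_fun D f -> (forall x, D x -> 0 <= f x) ->
  (\int[mu]_(x in D) (f x)%:E = r%:E)%E ->
  mu.-integrable D (fun x => (f x)%:E).
Proof.
move=> mD mf f0 fr; apply/integrableP; split; first exact/measurable_EFinP.
rewrite [X in (X < _)%E](_ : _ = r%:E) ?ltry// -fr.
by apply: eq_integral => x; rewrite inE => Dx; rewrite gee0_abs// lee_fin f0.
Qed.

Lemma integrable_bounded_factor (D : set R) (f g : R -> R) (M : R) :
  measurable D -> mu.-integrable D (fun x => (f x)%:E) ->
  measurable_fun D g -> (forall x, D x -> `|g x| <= M) ->
  mu.-integrable D (fun x => (f x * g x)%:E).
Proof.
move=> mD fi mg gM.
have bg : [bounded g x | x in D].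
  exists M; split; first exact: num_real.
  by move=> N /ltW MN x Dx; rewrite /= (le_trans (gM _ Dx)).
exact: (@integrableMl _ _ R mu D mD _ _ fi mg bg).
Qed.

Lemma tonelli_Rp (f : R * R -> R) : measurable_fun setT f ->
  (forall z, 0 <= f z) ->
  (\int[mu]_(x in Rp) \int[mu]_(y in Rp) (f (x, y))%:E =
   \int[mu]_(y in Rp) \int[mu]_(x in Rp) (f (x, y))%:E)%E.
Proof.
move=> mf f0.
(* The indicator of the quadrant turns both iterated integrals into integrals over the whole line,
   where [fubini_tonelli] applies. *)
pose g z := (f z * (\1_Rp z.1 * \1_Rp z.2))%:E.
have mRp : measurable Rp by exact: measurable_itv.
have mg : measurable_fun setT g.
  apply/measurable_EFinP; apply: measurable_funM => //.
  apply: measurable_funM.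
    apply: (measurableT_comp (measurable_indic mRp)); exact: measurable_fst.
  by apply: (measurableT_comp (measurable_indic mRp)); exact: measurable_snd.
have g0 z : (0 <= g z)%E by rewrite lee_fin !mulr_ge0.
have E1 x : (((fun x => \int[mu]_(y in Rp) (f (x, y))%:E) \_ Rp) x =
    \int[mu]_y g (x, y))%E.
  rewrite /patch; case: ifPn => xR; rewrite /g/= indicE ?xR ?(negbTE xR)/=.
    rewrite integral_mkcond; apply: eq_integral => y _.
    rewrite /patch; case: ifPn => yR; rewrite /g/= indicE ?yR ?(negbTE yR)/=.
      by rewrite !mulr1.
    by rewrite !mulr0.
  by rewrite integral0_eq// => y _; rewrite mul0r mulr0.
have E2 y : (((fun y => \int[mu]_(x in Rp) (f (x, y))%:E) \_ Rp) y =
    \int[mu]_x g (x, y))%E.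
  rewrite /patch; case: ifPn => xR; rewrite /g/= indicE ?xR ?(negbTE xR)/=.
    rewrite integral_mkcond; apply: eq_integral => x _.
    rewrite /patch; case: ifPn => yR; rewrite /g/= indicE ?yR ?(negbTE yR)/=.
      by rewrite !mulr1.
    by rewrite mul0r !mulr0.
  by rewrite integral0_eq// => x _; rewrite mulr0 mulr0.
rewrite integral_mkcond [RHS]integral_mkcond.
under eq_integral do rewrite E1.
under [RHS]eq_integral do rewrite E2.
exact: fubini_tonelli.
Qed.

Lemma integralZ_expR_cos (r a b b' c c' : R) : 0 < a -> `|c| + `|c'| <= 1 ->
  (\int[mu]_(x in Rp) (r * expR_cos a b b' c c' x)%:E =
  (r * (a^-1 + c * (a / (a ^+ 2 + b ^+ 2)) + c' * (a / (a ^+ 2 + b' ^+ 2))))%:E)%E.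
Proof.
move=> a0 cc1; have h := integral_expR_cos b b' a0 cc1.
have mRp : measurable (Rp : set R) by exact: measurable_itv.
have hi : mu.-integrable Rp (fun x => (expR_cos a b b' c c' x)%:E).
  apply: ge0_integrable h => //.
  - by apply: measurable_funTS; apply: continuous_measurable_fun; exact: continuous_expR_cos.
  - by move=> x _; exact: expR_cos_ge0.
by rewrite EFinM -h -(@integralZl _ _ R mu Rp mRp _ hi r).
Qed.

Lemma integral_expRN (a : R) : 0 < a ->
  (\int[mu]_(x in Rp) (expR (- (a * x)))%:E = (a^-1)%:E)%E.
Proof.
move=> a0; have := @integral_expR_cos a 0 0 0 0 a0.
rewrite normr0 addr0 ler01 => /(_ isT); rewrite !mul0r !addr0 => <-.
by apply: eq_integral => x _; rewrite /expR_cos !mul0r !addr0 mulr1.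
Qed.

Lemma measurable_expRN (a : R) (D : set R) :
  measurable_fun D (fun x : R => expR (- (a * x))).
Proof.
apply: measurable_funTS; apply: measurableT_comp => //.
by apply: measurableT_comp => //; exact: measurable_funM.
Qed.

Lemma integrable_expRN (a : R) : 0 < a ->
  mu.-integrable Rp (fun x => (expR (- (a * x)))%:E).
Proof.
move=> a0; apply: ge0_integrable (integral_expRN a0).
- exact: measurable_itv.
- exact: measurable_expRN.
- by move=> x _; exact: expR_ge0.
Qed.

(** * Sums of two shifted arctangents and integration by parts *)

Lemma is_derive1_atan_affine (k b x : R) :
  is_derive x 1 (fun y : R => atan (k * y + b)) (k / (1 + (k * x + b) ^+ 2)).
Proof.
have := is_derive1_comp (is_derive1_atan _) (is_derive1_affine k b x).
by move/is_derive1_eq; apply; rewrite mulrC.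
Qed.

Lemma continuous_affine (k b : R) : continuous (fun y : R => k * y + b).
Proof. by move=> x; apply: cvgD; [apply: cvgMr; exact: cvg_id|exact: cvg_cst]. Qed.

Lemma continuous_datan (k b : R) :
  continuous (fun y : R => k / (1 + (k * y + b) ^+ 2)).
Proof.
move=> x; apply: cvgMr; apply: cvgV.
  by rewrite gt_eqF// ltr_pwDl// sqr_ge0.
apply: cvgD; first exact: cvg_cst.
by apply: (cvg_comp _ (fun z => z ^+ 2) (@continuous_affine k b x)); exact: exprn_continuous.
Qed.

(** Used with b = k s, when it is atan (k (y - s)) + atan (k (y + s)). Keeping [b] free makes the
    derivative in y a sum of two affine cases. *)
Definition atan_pair (k b y : R) := atan (k * y - b) + atan (k * y + b).

Definition datan_pair (k b y : R) :=
  k / (1 + (k * y - b) ^+ 2) + k / (1 + (k * y + b) ^+ 2).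

Lemma is_derive1_atan_pair (k b x : R) :
  is_derive x 1 (atan_pair k b) (datan_pair k b x).
Proof.
exact: (is_deriveD (is_derive1_atan_affine k (- b) x) (is_derive1_atan_affine k b x)).
Qed.

Lemma continuous_datan_pair (k b : R) : continuous (datan_pair k b).
Proof. by move=> x; apply: cvgD; exact: continuous_datan. Qed.

Lemma continuous_atan_pair (k b : R) : continuous (atan_pair k b).
Proof.
move=> x; apply: differentiable_continuous; apply/derivable1_diffP.
by case: (is_derive1_atan_pair k b x).
Qed.

Lemma atan_pair_bound (k b x : R) : `|atan_pair k b x| <= pi.
Proof.
rewrite /atan_pair; have := atan_gtNpi2 (k * x - b); have := atan_gtNpi2 (k * x + b).
have := atan_ltpi2 (k * x - b); have := atan_ltpi2 (k * x + b).
rewrite ler_norml; lra.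
Qed.

Lemma datan_pair_bound (k b x : R) : 0 < k -> 0 <= datan_pair k b x <= k + k.
Proof.
move=> k0; have h u : 0 <= k / (1 + u ^+ 2) <= k.
  have u1 : 0 < 1 + u ^+ 2 by rewrite ltr_pwDl// sqr_ge0.
  apply/andP; split; first by rewrite divr_ge0// ltW.
  by rewrite ler_pdivrMr// ler_peMr ?lerDl ?sqr_ge0 ?ltW.
rewrite /datan_pair; have := h (k * x - b); have := h (k * x + b); lra.
Qed.

Lemma Rintegral_expRN (a : R) : 0 < a ->
  \int[mu]_(x in Rp) expR (- (a * x)) = a^-1.
Proof. by move=> a0; rewrite /Rintegral integral_expRN. Qed.

Lemma measurable_Rp : measurable (Rp : set R).
Proof. exact: measurable_itv. Qed.
Hint Resolve measurable_Rp : core.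

Lemma integrable_expRN_mul (a M : R) (g : R -> R) : 0 < a -> continuous g ->
  (forall x, `|g x| <= M) ->
  mu.-integrable Rp (fun x => (expR (- (a * x)) * g x)%:E).
Proof.
move=> a0 cg gM; apply: (@integrable_bounded_factor _ _ _ M) => //.
- exact: integrable_expRN.
- by apply: measurable_funTS; exact: continuous_measurable_fun.
Qed.

(** Both boundary terms vanish: at 0 because atan is odd, so [atan_pair k b 0 = 0], and at infinity
    because the exponential decays while the pair is bounded by pi. *)
Lemma integral_by_parts_atan (a k b : R) : 0 < a -> 0 < k ->
  \int[mu]_(x in Rp) (expR (- (a * x)) * datan_pair k b x) =
  a * \int[mu]_(x in Rp) (expR (- (a * x)) * atan_pair k b x).
Proof.
move=> a0 k0.
(* Subtracting pi makes the derivative of [G] nonnegative, as [FTCy] requires. The integral of this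
   derivative is then - G 0 = pi, which cancels against a times the integral of pi exp (- a x). *)
pose G (x : R) := expR (- (a * x)) * (atan_pair k b x - pi).
have dG (x : R) : is_derive x 1 G (expR (- (a * x)) * datan_pair k b x
    + (a * (pi * expR (- (a * x)) - expR (- (a * x)) * atan_pair k b x))).
  have := is_derive1M (is_derive1_expRN a x)
    (is_deriveB (is_derive1_atan_pair k b x) (is_derive_cst pi x 1)).
  by move/is_derive1_eq; apply; rewrite !fctE /=; ring.
have Gy : G x @[x --> +oo] --> 0.
  apply: (@cvgy_mul0 _ _ (pi + pi)); first exact: cvgy_expRN.
  move=> x; rewrite (le_trans (ler_normB _ _))// lerD ?atan_pair_bound//.
  by rewrite ger0_norm// pi_ge0.
have i1 : mu.-integrable Rp (fun x => (expR (- (a * x)) * datan_pair k b x)%:E).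
  apply: (@integrable_expRN_mul _ (k + k)) => //.
    exact: continuous_datan_pair.
  by move=> x; have /andP[? ?] := datan_pair_bound b x k0; rewrite ger0_norm.
have i2 : mu.-integrable Rp (fun x => (expR (- (a * x)) * atan_pair k b x)%:E).
  apply: (@integrable_expRN_mul _ pi) => //; first exact: continuous_atan_pair.
  exact: atan_pair_bound.
have i3 := integrable_expRN a0.
have i4 : mu.-integrable Rp (fun x => (pi * expR (- (a * x)))%:E).
  exact: (@integrableZl _ _ R mu Rp measurable_Rp pi _ i3).
have i5 : mu.-integrable Rp
    (fun x => (pi * expR (- (a * x)) - expR (- (a * x)) * atan_pair k b x)%:E).
  exact: (@integrableB _ _ R mu Rp measurable_Rp _ _ i4 i2).
have i6 : mu.-integrable Rp
    (fun x => (a * (pi * expR (- (a * x)) - expR (- (a * x)) * atan_pair k b x))%:E).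
  exact: (@integrableZl _ _ R mu Rp measurable_Rp a _ i5).
have : \int[mu]_(x in Rp) (expR (- (a * x)) * datan_pair k b x
    + (a * (pi * expR (- (a * x)) - expR (- (a * x)) * atan_pair k b x))) = pi.
  rewrite /Rintegral (FTCy _ _ dG Gy).
  - rewrite /G /atan_pair !mulr0 oppr0 expR0 !add0r atanN addNr/=; lra.
  - move=> x _; have /andP[d0 _] := datan_pair_bound b x k0.
    rewrite addr_ge0//; first by rewrite mulr_ge0// expR_ge0.
    rewrite mulr_ge0//; first exact: ltW.
    rewrite subr_ge0 mulrC ler_wpM2r ?expR_ge0//.
    exact: le_trans (ler_norm _) (atan_pair_bound _ _ _).
  - move=> x; have cE := @continuous_expRN a x.
    apply: cvgD; first by apply: cvgM => //; exact: continuous_datan_pair.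
    apply: cvgMr; apply: cvgB; first exact: cvgMr.
    by apply: cvgM => //; exact: continuous_atan_pair.
rewrite (@RintegralD _ _ R mu _ _ _ measurable_Rp i1 i6).
rewrite (@RintegralZl _ _ R mu _ _ a measurable_Rp i5).
rewrite (@RintegralB _ _ R mu _ _ _ measurable_Rp i4 i2).
rewrite (@RintegralZl _ _ R mu _ _ pi measurable_Rp i3) Rintegral_expRN// mulrBr.
by rewrite mulrCA mulfV ?gt_eqF// mulr1; lra.
Qed.

(** * The Poisson kernel and its cosine transform on the half-line *)

(** Up to the factor 1 / pi, the Poisson kernel of the upper half-plane at height [a]. *)
Definition poisson (a x : R) := a / (a ^+ 2 + x ^+ 2).

Lemma poisson_den (a x : R) : 0 < a -> 0 < a ^+ 2 + x ^+ 2.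
Proof. by move=> a0; rewrite ltr_pwDl ?exprn_gt0// sqr_ge0. Qed.

Lemma poisson_ge0 (a x : R) : 0 < a -> 0 <= poisson a x.
Proof. by move=> a0; rewrite divr_ge0 ?ltW// poisson_den. Qed.

Lemma poisson_le (a x : R) : 0 < a -> poisson a x <= a^-1.
Proof.
move=> a0; rewrite ler_pdivrMr ?poisson_den// mulrDr expr2 mulKf ?gt_eqF//.
by rewrite lerDl mulr_ge0 ?invr_ge0 ?sqr_ge0 ?ltW.
Qed.

Lemma continuous_poisson (a : R) : 0 < a -> continuous (poisson a).
Proof.
move=> a0 x; apply: cvgMr; apply: cvgV; first by rewrite gt_eqF// poisson_den.
by apply: cvgD; [exact: cvg_cst|exact: exprn_continuous].
Qed.

Lemma integral_poisson (a : R) : 0 < a ->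
  (\int[mu]_(x in Rp) (poisson a x)%:E = (pi / 2)%:E)%E.
Proof.
move=> a0.
have dF (x : R) : is_derive x 1 (fun y : R => atan (a^-1 * y + 0)) (poisson a x).
  have := is_derive1_atan_affine a^-1 0 x.
  move/is_derive1_eq; apply; rewrite addr0 /poisson; field.
  by rewrite !gt_eqF// poisson_den.
have Fy : atan (a^-1 * x + 0) @[x --> +oo] --> pi / 2.
  apply: (cvg_comp (fun x => a^-1 * x + 0) atan _ (@cvgy_atan R)).
  rewrite (_ : (fun _ => _) = ( *%R a^-1)); last by apply/funext => y; rewrite addr0.
  by apply: gt0_cvgMry; [rewrite invr_gt0|exact: cvg_id].
rewrite (FTCy _ _ dF Fy).
- by rewrite mulr0 addr0 atan0 subr0.
- by move=> x _; exact: poisson_ge0.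
- exact: continuous_poisson.
Qed.

Lemma integrable_poisson (a : R) : 0 < a ->
  mu.-integrable Rp (fun x => (poisson a x)%:E).
Proof.
move=> a0; apply: ge0_integrable (integral_poisson a0) => //.
- by apply: measurable_funTS; apply: continuous_measurable_fun; exact: continuous_poisson.
- by move=> x _; exact: poisson_ge0.
Qed.

(** Both sides come from one double integral, of exp (- x / k) exp (- a y) cos (s x) cos (x y):
    integrating in y first gives the left side, in x first the right side after integration by
    parts. *)
Lemma damped_integral_poisson_cos (a k s : R) : 0 < a -> 0 < k ->
  \int[mu]_(x in Rp) (expR (- (k^-1 * x)) * (cos (s * x) * poisson a x)) =
  a / 2 * \int[mu]_(y in Rp) (expR (- (a * y)) * atan_pair k (k * s) y).
Proof.
move=> a0 k0; have k1 : 0 < k^-1 by rewrite invr_gt0.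
(* The added 1 makes [f] nonnegative, so that Tonelli applies. It contributes k / a to each iterated
   integral, and these terms are cancelled at the end by [addrI]. *)
pose f (z : R * R) := expR (- (k^-1 * z.1)) * (expR (- (a * z.2)) *
  (1 + cos (s * z.1) * cos (z.1 * z.2))).
have f0 (z : R * R) : 0 <= f z by rewrite /f !mulr_ge0 ?expR_ge0.
have mcos : measurable_fun setT (@cos R).
  by apply: continuous_measurable_fun; exact: continuous_cos.
have mf : measurable_fun setT f.
  apply: measurable_funM; [|apply: measurable_funM].
  - apply: (measurableT_comp (@measurable_expRN k^-1 setT)); exact: measurable_fst.
  - apply: (measurableT_comp (@measurable_expRN a setT)); exact: measurable_snd.
  - apply: measurable_funD => //; apply: measurable_funM.
    + apply: (measurableT_comp mcos); apply: measurable_funM => //; exact: measurable_fst.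
    + apply: (measurableT_comp mcos); apply: measurable_funM.
        exact: measurable_fst.
      exact: measurable_snd.
have := tonelli_Rp mf f0.
have inner1 x : (\int[mu]_(y in Rp) (f (x, y))%:E =
    (expR (- (k^-1 * x)) * (a^-1 + cos (s * x) * poisson a x))%:E)%E.
  have := @integralZ_expR_cos (expR (- (k^-1 * x))) a x 0 (cos (s * x)) 0 a0.
  rewrite normr0 addr0 cos_max => /(_ isT); rewrite mul0r addr0 => <-.
  by apply: eq_integral => y _; rewrite /expR_cos mul0r addr0.
have inner2 y : (\int[mu]_(x in Rp) (f (x, y))%:E =
    (expR (- (a * y)) * (k + 2^-1 * datan_pair k (k * s) y))%:E)%E.
  have := @integralZ_expR_cos (expR (- (a * y))) k^-1 (s - y) (s + y) 2^-1 2^-1 k1.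
  have half : `|2^-1| + `|2^-1| <= 1 :> R by rewrite ger0_norm ?invr_ge0//; lra.
  (* The Laplace value at damping 1 / k is the derivative of atan (k u) in u. *)
  have E (u : R) : k^-1 / (k^-1 ^+ 2 + u ^+ 2) = k / (1 + (k * u) ^+ 2).
    field; rewrite (gt_eqF k0) gt_eqF//.
    by rewrite ltr_pwDl// sqr_ge0.
  move/(_ half); rewrite !E invrK => h.
  (* Product to sum: cos (s x) cos (x y) is half of cos ((s - y) x) + cos ((s + y) x). *)
  transitivity (\int[mu]_(x in Rp) (expR (- (a * y)) *
      expR_cos k^-1 (s - y) (s + y) 2^-1 2^-1 x)%:E)%E.
    apply: eq_integral => x _; congr EFin; rewrite /f/= /expR_cos.
    rewrite mulrCA; congr (_ * (_ * _)).
    rewrite mulrBl mulrDl cosB cosD (mulrC x y).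
    by field.
  rewrite h /datan_pair; congr (_ * _)%:E.
  have -> : k * (s - y) = - (k * y - k * s) by ring.
  have -> : k * (s + y) = k * y + k * s by ring.
  by rewrite sqrrN mulrDr addrA.
under eq_integral do rewrite inner1.
under [X in _ = X -> _]eq_integral do rewrite inner2.
move/(congr1 fine).
have mRp := measurable_Rp.
have ccos (x : R) : {for x, continuous (fun x => cos (s * x) * poisson a x)}.
  by apply: cvgM; [exact: continuous_cos_mul|exact: continuous_poisson].
have i1 : mu.-integrable Rp
    (fun x => (expR (- (k^-1 * x)) * (cos (s * x) * poisson a x))%:E).
  apply: (@integrable_expRN_mul _ a^-1) => // x.
  rewrite normrM (ger0_norm (poisson_ge0 x a0)).
  by rewrite -[leRHS]mul1r ler_pM ?cos_max ?poisson_le ?poisson_ge0.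
have i2 : mu.-integrable Rp (fun y => (expR (- (a * y)) * datan_pair k (k * s) y)%:E).
  apply: (@integrable_expRN_mul _ (k + k)) => //; first exact: continuous_datan_pair.
  by move=> x; have /andP[? ?] := datan_pair_bound (k * s) x k0; rewrite ger0_norm.
have i3 := integrable_expRN k1.
have i4 := integrable_expRN a0.
have i5 : mu.-integrable Rp (fun x => (a^-1 * expR (- (k^-1 * x)))%:E).
  exact: (@integrableZl _ _ R mu Rp mRp a^-1 _ i3).
have i6 : mu.-integrable Rp (fun x => (k * expR (- (a * x)))%:E).
  exact: (@integrableZl _ _ R mu Rp mRp k _ i4).
have i7 : mu.-integrable Rp
    (fun y => (2^-1 * (expR (- (a * y)) * datan_pair k (k * s) y))%:E).
  exact: (@integrableZl _ _ R mu Rp mRp 2^-1 _ i2).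
rewrite -/(Rintegral mu Rp _) -/(Rintegral mu Rp _).
under eq_Rintegral do rewrite mulrDr (mulrC _ a^-1).
under [X in _ = X -> _]eq_Rintegral do rewrite mulrDr (mulrC _ k) mulrCA.
rewrite (@RintegralD _ _ R mu _ _ _ mRp i5 i1) (@RintegralD _ _ R mu _ _ _ mRp i6 i7).
rewrite (@RintegralZl _ _ R mu _ _ a^-1 mRp i3) (@RintegralZl _ _ R mu _ _ k mRp i4).
rewrite (@RintegralZl _ _ R mu _ _ 2^-1 mRp i2) !Rintegral_expRN// invrK.
rewrite (mulrC k) => /addrI ->; rewrite integral_by_parts_atan//.
by rewrite mulrA (mulrC 2^-1).
Qed.

Lemma integral_itvy_expRN (a s : R) : 0 < a ->
  (\int[mu]_(x in `[s, +oo[) (expR (- (a * x)))%:E = (a^-1 * expR (- (a * s)))%:E)%E.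
Proof.
move=> a0.
have dF (x : R) : is_derive x 1 (fun x : R => - a^-1 * expR (- (a * x))) (expR (- (a * x))).
  have := is_deriveZ (- a^-1) (is_derive1_expRN a x).
  move/is_derive1_eq; apply; rewrite /GRing.scale/=.
  by field; rewrite gt_eqF.
have Fy : - a^-1 * expR (- (a * x)) @[x --> +oo] --> (0 : R).
  by rewrite -(mulr0 (- a^-1)); apply: cvgMr; exact: cvgy_expRN.
rewrite (FTCy _ _ dF Fy); first by rewrite sub0r mulNr opprK.
- by move=> x _; exact: expR_ge0.
- exact: continuous_expRN.
Qed.

(** The sign covers u = 0 as well, so the limit holds at every point; [n.+1] rather than [n] fits
    the later condition 0 < k. *)
Lemma cvg_atan_natM (u : R) : atan (n.+1%:R * u) @[n --> \oo] --> pi / 2 * Num.sg u.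
Proof.
have pos (v : R) : 0 < v -> atan (n.+1%:R * v) @[n --> \oo] --> pi / 2.
  move=> v0; apply: (cvg_comp (fun n => n.+1%:R * v) atan _ (@cvgy_atan R)).
  apply/cvgryPge => A; near=> n; rewrite -ler_pdivrMr//.
  apply: (@le_trans _ _ n%:R); last by rewrite ler_nat.
  by near: n; exact: nbhs_infty_ger.
case: (ltgtP u 0) => u0.
- rewrite ltr0_sg// mulrN1 -[u]opprK.
  rewrite (_ : (fun n => _) = (fun n => - atan (n.+1%:R * - u))); last first.
    by apply/funext => n; rewrite mulrN atanN.
  by apply: cvgN; apply: pos; rewrite oppr_gt0.
- by rewrite gtr0_sg// mulr1; exact: pos.
- rewrite u0 sgr0 mulr0 (_ : (fun n => _) = cst 0); first exact: cvg_cst.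
  by apply/funext => n; rewrite mulr0 atan0.
Unshelve. all: by end_near. Qed.

(** Dominated convergence for real-valued integrals. Measurability of the limit is part of the
    conclusion because one of the limits below involves the discontinuous sign function. *)
Lemma Rintegral_dominated_cvg (D : set R) (f_ : nat -> R -> R) (f g : R -> R) :
  measurable D -> (forall n, continuous (f_ n)) ->
  (forall x, D x -> f_ n x @[n --> \oo] --> f x) ->
  mu.-integrable D (fun x => (g x)%:E) ->
  (forall n x, D x -> `|f_ n x| <= g x) ->
  measurable_fun D f /\
  \int[mu]_(x in D) f_ n x @[n --> \oo] --> \int[mu]_(x in D) f x.
Proof.
move=> mD cf ff gi fg.
have mf_ n : measurable_fun D (fun x => (f_ n x)%:E).
  apply/measurable_EFinP; apply: measurable_funTS.
  exact: continuous_measurable_fun.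
have ffE x : D x -> (f_ n x)%:E @[n --> \oo] --> (f x)%:E.
  by move=> Dx; apply: cvg_EFin; [exact: nearW|exact: ff].
have mfE : measurable_fun D (fun x => (f x)%:E).
  exact: (emeasurable_fun_cvg (fun n x => (f_ n x)%:E)).
have fgE n x : D x -> (`|(f_ n x)%:E| <= (g x)%:E)%E.
  by move=> Dx; rewrite lee_fin fg.
split; first exact/measurable_EFinP.
apply: fine_cvg; rewrite fineK.
  exact: (@dominated_cvg _ _ R mu D mD _ _ _ mf_ ffE _ gi fgE).
apply: (@integrable_fin_num _ _ R mu D mD).
apply: (@le_integrable _ _ R mu D mD _ _ mfE _ gi) => x Dx.
rewrite lee_fin (le_trans _ (ler_norm _))//.
apply: (cvgr_to_le (cvg_norm (ff _ Dx))).
by apply: nearW => n; exact: fg.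
Qed.

(** Take k = n + 1 in the damped identity and let n grow. The left integrands are dominated by
    [poisson a], the right ones by pi exp (- a y); uniqueness of limits then gives the value. *)
Lemma Rintegral_poisson_cos (a s : R) : 0 < a -> 0 <= s ->
  \int[mu]_(x in Rp) (cos (s * x) * poisson a x) = pi / 2 * expR (- (a * s)).
Proof.
move=> a0 s0; have mRp := measurable_Rp.
(* Pointwise limit of the arctangent pairs: on the half-line it is 0 for y < s and pi for y > s. *)
pose sg2 y : R := pi / 2 * Num.sg (y - s) + pi / 2 * Num.sg (y + s).
have [_ T1] : measurable_fun Rp (fun x => cos (s * x) * poisson a x) /\
    \int[mu]_(x in Rp) (expR (- (n.+1%:R^-1 * x)) * (cos (s * x) * poisson a x))
      @[n --> \oo] --> \int[mu]_(x in Rp) (cos (s * x) * poisson a x).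
  apply: (Rintegral_dominated_cvg _ _ _ (integrable_poisson a0)) => //.
  - move=> n x; apply: cvgM; first exact: continuous_expRN.
    by apply: cvgM; [exact: continuous_cos_mul|exact: continuous_poisson].
  - move=> x _; rewrite -[X in _ --> X]mul1r; apply: cvgMl.
    rewrite [X in _ --> X](_ : 1 = expR (- (0 * x))); last by rewrite mul0r oppr0 expR0.
    apply: (cvg_comp (fun n : nat => - (n.+1%:R^-1 * x)) expR _ (@continuous_expR R _)).
    by apply: cvgN; apply: cvgMl; exact: cvg_harmonic.
  - move=> n x; rewrite /= in_itv/= andbT => x0.
    rewrite normrM ger0_norm ?expR_ge0// normrM (ger0_norm (poisson_ge0 x a0)).
    have e1 : expR (- (n.+1%:R^-1 * x)) <= 1.
      by rewrite -[leRHS]expR0 ler_expR oppr_le0 mulr_ge0 ?invr_ge0.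
    have c1 : `|cos (s * x)| * poisson a x <= poisson a x.
      by rewrite ler_piMl ?poisson_ge0 ?cos_max.
    by rewrite (le_trans _ c1)// ler_piMl// mulr_ge0 ?poisson_ge0.
have [mh T2] : measurable_fun Rp (fun y => expR (- (a * y)) * sg2 y) /\
    \int[mu]_(y in Rp) (expR (- (a * y)) * atan_pair n.+1%:R (n.+1%:R * s) y)
      @[n --> \oo] --> \int[mu]_(y in Rp) (expR (- (a * y)) * sg2 y).
  apply: (@Rintegral_dominated_cvg _ _ _ (fun y => expR (- (a * y)) * pi)) => //.
  - by move=> n x; apply: cvgM; [exact: continuous_expRN|exact: continuous_atan_pair].
  - move=> x _; apply: cvgMr; rewrite /atan_pair; under eq_fun do rewrite -mulrBr -mulrDr.
    by apply: cvgD; exact: cvg_atan_natM.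
  - apply: (@integrable_expRN_mul _ pi) => //; first exact: cst_continuous.
    by rewrite ger0_norm// pi_ge0.
  - move=> n x _; rewrite normrM ger0_norm ?expR_ge0// ler_wpM2l ?expR_ge0//.
    exact: atan_pair_bound.
have I : \int[mu]_(y in Rp) (expR (- (a * y)) * sg2 y) = pi * (a^-1 * expR (- (a * s))).
  have U : Rp = `[0, s[ `|` `[s, +oo[ :> set R.
    apply/seteqP; split => x /=; rewrite !in_itv/= !andbT.
      by move=> x0; rewrite x0/=; case: (ltP x s) => ?; [left|right].
    by move=> [/andP[]//|]; exact: le_trans.
  have mhE : measurable_fun Rp (fun y => (expR (- (a * y)) * sg2 y)%:E).
    exact/measurable_EFinP.
  have m1 : measurable (`[0, s[ : set R) by exact: measurable_itv.
  have m2 : measurable (`[s, +oo[ : set R) by exact: measurable_itv.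
  rewrite /Rintegral; rewrite U in mhE *.
  rewrite (@integral_setU _ _ R mu _ _ _ m1 m2 mhE); last first.
    apply/disj_setPS => x [] /=; rewrite !in_itv/= andbT => /andP[_ xs].
    by rewrite leNgt xs.
  rewrite integral0_eq ?add0e; last first.
    move=> x /=; rewrite in_itv/= => /andP[x0 xs].
    rewrite /sg2 ltr0_sg ?subr_lt0// gtr0_sg ?ltr_wpDl// ?(le_lt_trans _ xs)//.
    by rewrite mulrN1 mulr1 addNr mulr0.
  (* The endpoint s, where [sg2] is not equal to pi, is a null set and is removed before [sg2] is
     replaced by pi. *)
  rewrite -integral_itv_obnd_cbnd; last first.
    apply: measurable_funS mhE; first exact: measurableU.
    by move=> x /=; rewrite !in_itv/= !andbT => /ltW; right.
  transitivity (fine (\int[mu]_(x in `]s, +oo[) (pi * expR (- (a * x)))%:E)).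
    congr fine; apply: eq_integral => x; rewrite inE/= in_itv/= andbT => sx.
    have x0 : 0 < x by exact: le_lt_trans sx.
    rewrite /sg2 (gtr0_sg (x := x - s)) ?subr_gt0// gtr0_sg ?ltr_wpDr//.
    by rewrite mulr1 -splitr mulrC.
  rewrite integral_itv_obnd_cbnd; last first.
    apply/measurable_EFinP; apply: measurable_funM => //; exact: measurable_expRN.
  under eq_integral do rewrite EFinM.
  rewrite (@integralZl _ _ R mu _ m2); first by rewrite integral_itvy_expRN.
  apply: ge0_integrable (integral_itvy_expRN s a0) => //; exact: measurable_expRN.
have : a / 2 * \int[mu]_(y in Rp) (expR (- (a * y)) * atan_pair n.+1%:R (n.+1%:R * s) y)
   @[n --> \oo] --> a / 2 * (pi * (a^-1 * expR (- (a * s)))).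
  by rewrite -I; exact: cvgMr.
under eq_fun do rewrite -damped_integral_poisson_cos//.
move/(cvg_unique _ T1) => ->//; field.
by rewrite gt_eqF.
Qed.

(** * From the half-line to the whole line: the Fourier transform *)

Lemma ge0_integralT_split (f : R -> R) : (forall x, 0 <= f x) -> continuous f ->
  (\int[mu]_x (f x)%:E =
   \int[mu]_(x in Rp) (f x)%:E + \int[mu]_(x in Rp) (f (- x))%:E)%E.
Proof.
move=> f0 cf.
have mf : measurable_fun [set: R] f by exact: continuous_measurable_fun.
have mN : measurable (`]-oo, 0[ : set R) by exact: measurable_itv.
have U : setT = `]-oo, 0[ `|` Rp :> set R.
  apply/seteqP; split => // x _ /=; rewrite !in_itv/= andbT.
  by case: (ltP x 0) => ?; [left|right].
rewrite U ge0_integral_setU//=.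
- rewrite addeC; congr (_ + _)%E.
  rewrite integral_itv_bndo_bndc; last exact/measurable_EFinP/measurable_funTS.
  rewrite -{1}oppr0 ge0_integration_by_substitutionNy//.
  exact: continuous_subspaceT.
- by apply/measurable_EFinP; exact: measurable_funTS.
- by move=> x _; rewrite lee_fin.
- apply/disj_setPS => x [] /=; rewrite !in_itv/= andbT => xs.
  by rewrite leNgt xs.
Qed.

Lemma poissonN (a x : R) : poisson a (- x) = poisson a x.
Proof. by rewrite /poisson sqrrN. Qed.

Lemma integrable_poissonT (a : R) : 0 < a ->
  mu.-integrable setT (fun x => (poisson a x)%:E).
Proof.
move=> a0; apply: (@ge0_integrable _ _ (pi / 2 + pi / 2)) => //.
- by apply: continuous_measurable_fun; exact: continuous_poisson.
- by move=> x _; exact: poisson_ge0.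
rewrite (ge0_integralT_split (fun x => poisson_ge0 x a0) (continuous_poisson a0)).
under [X in (_ + X)%E]eq_integral do rewrite poissonN.
by rewrite integral_poisson// -EFinD.
Qed.

(** Since [|g| <= 1], the function 1 + g is nonnegative and the splitting for nonnegative integrands
    applies to it; subtracting the splitting of the kernel itself leaves the claim for the signed
    [g]. *)
Lemma Rintegral_poisson_split (a : R) (g : R -> R) : 0 < a -> continuous g ->
  (forall x, `|g x| <= 1) ->
  \int[mu]_x (poisson a x * g x) =
  \int[mu]_(x in Rp) (poisson a x * g x) +
  \int[mu]_(x in Rp) (poisson a x * g (- x)).
Proof.
move=> a0 cg g1.
have mT : measurable (setT : set R) by exact: measurableT.
have cgN : continuous (g \o -%R).
  by move=> x; apply: (cvg_comp -%R g _ (@cg (- x))); exact: opp_continuous.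
have int (h : R -> R) : continuous h -> (forall x, `|h x| <= 1) ->
    forall D : set R, measurable D -> mu.-integrable D (fun x => (poisson a x)%:E) ->
    mu.-integrable D (fun x => (poisson a x * h x)%:E) /\
    \int[mu]_(x in D) (poisson a x * (1 + h x)) =
    \int[mu]_(x in D) (poisson a x) + \int[mu]_(x in D) (poisson a x * h x) /\
    (\int[mu]_(x in D) (poisson a x * (1 + h x))%:E)%E \is a fin_num.
  move=> ch h1 D mD pD.
  have i1 : mu.-integrable D (fun x => (poisson a x * h x)%:E).
    apply: (@integrable_bounded_factor _ _ _ 1) => //.
    by apply: measurable_funTS; exact: continuous_measurable_fun.
  have i2 : mu.-integrable D (fun x => (poisson a x + poisson a x * h x)%:E).
    exact: (@integrableD _ _ R mu D mD _ _ pD i1).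
  split=> //.
  under eq_integral do rewrite mulrDr mulr1.
  under eq_Rintegral do rewrite mulrDr mulr1.
  split; first exact: (@RintegralD _ _ R mu _ _ _ mD pD i1).
  exact: (@integrable_fin_num _ _ R mu D mD _ i2).
have [iT [eT _]] := int g cg g1 setT mT (integrable_poissonT a0).
have [i1 [e1 f1]] := int g cg g1 Rp measurable_Rp (integrable_poisson a0).
have [i2 [e2 f2]] := int _ cgN (fun x => g1 (- x)) Rp measurable_Rp (integrable_poisson a0).
have ge0 x : 0 <= poisson a x * (1 + g x).
  rewrite mulr_ge0 ?poisson_ge0//.
  by have := g1 x; rewrite ler_norml; lra.
have cP : continuous (fun x => poisson a x * (1 + g x)).
  move=> x; apply: cvgM; first exact: continuous_poisson.
  by apply: cvgD; [exact: cvg_cst|exact: cg].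
have P2 : \int[mu]_x poisson a x =
    \int[mu]_(x in Rp) poisson a x + \int[mu]_(x in Rp) poisson a x.
  rewrite /Rintegral (ge0_integralT_split (fun x => poisson_ge0 x a0) (continuous_poisson a0)).
  under [X in (_ + X)%E]eq_integral do rewrite poissonN.
  by rewrite integral_poisson.
have : \int[mu]_x (poisson a x * (1 + g x)) =
    \int[mu]_(x in Rp) (poisson a x * (1 + g x)) +
    \int[mu]_(x in Rp) (poisson a x * (1 + (g \o -%R) x)).
  rewrite /Rintegral (ge0_integralT_split ge0 cP) -fineD//.
  by under [X in fine (_ + X) = _]eq_integral do rewrite poissonN.
by rewrite eT e1 e2 P2 addrACA => /addrI.
Qed.

(** The cosine part is even in x and in xi, hence twice the half-line integral at s = |xi|; the sine
    part is odd and its halves cancel. The two square roots multiply to 1 / pi, which is [c0] at p =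
    pi. *)
Lemma fourier_poisson (a xi : R) : 0 < a ->
  fourier_real (fun x => Num.sqrt (2 / pi) * (a / (a ^+ 2 + x ^+ 2))) xi =
  (expR (- (a * `|xi|)))%:C%C.
Proof.
move=> a0.
have mT : measurable (setT : set R) by exact: measurableT.
have iP (g : R -> R) : continuous g -> (forall x, `|g x| <= 1) ->
    mu.-integrable setT (fun x => (poisson a x * g x)%:E).
  move=> cg g1; apply: (@integrable_bounded_factor _ _ _ 1) => //.
  - exact: integrable_poissonT.
  - exact: continuous_measurable_fun.
rewrite /fourier_real /fourier /complex_integral /expi.
have -> : \int[mu]_x complex.Re
   ((Num.sqrt (2 / pi) * (a / (a ^+ 2 + x ^+ 2)))%:C%C *
    (cos (- (x * xi)) +i* sin (- (x * xi)))%C) = 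
   Num.sqrt (2 / pi) * (pi * expR (- (a * `|xi|))).
  transitivity (\int[mu]_x (Num.sqrt (2 / pi) * (poisson a x * cos (`|xi| * x)))).
    apply: eq_Rintegral => x _ /=; rewrite mul0r subr0 cosN -mulrA.
    have -> : cos (x * xi) = cos (`|xi| * x); last by rewrite mulrA.
    by rewrite mulrC; case: (ger0P xi) => // _; rewrite mulNr cosN.
  rewrite (@RintegralZl _ _ R mu _ _ _ mT); last first.
    by apply: iP => [|x]; [exact: continuous_cos_mul|exact: cos_max].
  rewrite (Rintegral_poisson_split a0 (@continuous_cos_mul _))// => [|x]; last first.
    exact: cos_max.
  under eq_Rintegral do rewrite mulrC.
  under [X in _ * (_ + X)]eq_Rintegral do rewrite mulrN cosN mulrC.
  by rewrite Rintegral_poisson_cos// -mulrDl -splitr.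
have -> : \int[mu]_x complex.Im
   ((Num.sqrt (2 / pi) * (a / (a ^+ 2 + x ^+ 2)))%:C%C *
    (cos (- (x * xi)) +i* sin (- (x * xi)))%C) = 0.
  transitivity (\int[mu]_x (Num.sqrt (2 / pi) * (poisson a x * sin (- xi * x)))).
    apply: eq_Rintegral => x _ /=; rewrite mul0r addr0 -mulrA.
    by rewrite mulNr (mulrC xi).
  have csin : continuous (fun x : R => sin (- xi * x)).
    move=> x; apply: (cvg_comp ( *%R (- xi)) sin _ (@continuous_sin R _)).
    by apply: cvgMr; exact: cvg_id.
  rewrite (@RintegralZl _ _ R mu _ _ _ mT); last first.
    by apply: iP => // x; exact: sin_max.
  rewrite (Rintegral_poisson_split a0 csin)// => [|x]; last exact: sin_max.
  under [X in _ * (_ + X)]eq_Rintegral do rewrite mulrN sinN mulrN -mulN1r.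
  rewrite (@RintegralZl _ _ R mu _ _ _ measurable_Rp); last first.
    apply: (@integrable_bounded_factor _ _ _ 1) => //.
    - exact: integrable_poisson.
    - by apply: measurable_funTS; exact: continuous_measurable_fun.
    - by move=> x _; exact: sin_max.
  by rewrite mulN1r subrr mulr0.
have c0 (p : R) : 0 < p -> (Num.sqrt (2 * p))^-1 * (Num.sqrt (2 / p) * p) = 1.
  move=> p0; rewrite mulrA -sqrtrV ?mulr_ge0 ?ltW// -sqrtrM ?invr_ge0 ?mulr_ge0 ?ltW//.
  rewrite (_ : (2 * p)^-1 * (2 / p) = (p^-1) ^+ 2); last by field; rewrite gt_eqF.
  by rewrite sqrtr_sqr ger0_norm ?invr_ge0 ?ltW// mulVf// gt_eqF.
apply/eqP; rewrite eq_complex /= !mulr0 !mul0r subr0 addr0 eqxx andbT.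
by rewrite (mulrA (Num.sqrt (2 / pi))) mulrA c0 ?pi_gt0 ?mul1r.
Qed.

(** * Conditions (A1) and (A2), and the minimum on [-pi, pi] *)

Local Notation phi a := (fun x : R => Num.sqrt (2 / pi) * (a / (a ^+ 2 + x ^+ 2))).

Lemma integrableT_expRN_norm (a : R) : 0 < a ->
  mu.-integrable setT (fun x => (expR (- (a * `|x|)))%:E).
Proof.
move=> a0.
have cE : continuous (fun x : R => expR (- (a * `|x|))).
  by move=> x; apply: (cvg_comp Num.norm (fun y => expR (- (a * y)))
    (@norm_continuous _ _ x)); exact: continuous_expRN.
have E0 (x : R) : 0 <= expR (- (a * `|x|)) by exact: expR_ge0.
apply: (@ge0_integrable _ _ (a^-1 + a^-1)) => //.
  exact: continuous_measurable_fun.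
have half : (\int[mu]_(x in Rp) (expR (- (a * `|x|)))%:E = (a^-1)%:E)%E.
  rewrite -integral_expRN//; apply: eq_integral => x.
  by rewrite inE/= in_itv/= andbT => x0; rewrite ger0_norm.
rewrite (ge0_integralT_split E0 cE).
by under [X in (_ + X)%E]eq_integral do rewrite normrN; rewrite half -EFinD.
Qed.

Lemma condA1_poisson (a : R) : 0 < a -> condA1 (phi a).
Proof.
move=> a0; split.
  exact: (@integrableZl _ _ R mu _ (@measurableT _ _) _ _ (integrable_poissonT a0)).
rewrite (funext (fun xi => fourier_poisson xi a0)); split => /=.
  exact: integrableT_expRN_norm.
exact: integrable0.
Qed.

Lemma condA2_poisson (a : R) : 0 < a -> condA2 (phi a).
Proof.
move=> a0; split=> [xi|].
  by rewrite fourier_poisson// lecR expR_ge0.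
(* The transform decreases in |xi|, so its least value on [-pi, pi] is taken at the endpoints. *)
exists (expR (- (a * pi))); first exact: expR_gt0.
by move=> xi xipi; rewrite fourier_poisson// lecR ler_expR lerN2 ler_pM2l.
Qed.

Lemma Re_fourier_poisson (a xi : R) : 0 < a ->
  complex.Re (fourier_real (phi a) xi) = expR (- (a * `|xi|)).
Proof. by move=> a0; rewrite fourier_poisson. Qed.

Lemma minf_poisson (a : R) : 0 < a -> minf (phi a) = expR (- (a * pi)).
Proof.
move=> a0; apply/eqP; rewrite eq_le; apply/andP; split.
  apply: ge_inf.
    by exists 0 => _ [xi _ <-]; rewrite Re_fourier_poisson// expR_ge0.
  exists pi; first by rewrite /= ger0_norm// pi_ge0.
  by rewrite Re_fourier_poisson// ger0_norm// pi_ge0.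
apply: lb_le_inf.
  by exists (complex.Re (fourier_real (phi a) 0)), 0; rewrite //= normr0 pi_ge0.
by move=> _ [xi xipi <-]; rewrite Re_fourier_poisson// ler_expR lerN2 ler_pM2l.
Qed.

(** * Bounds on the suprema, their sum over nonzero j, and (A3) *)

Lemma Msup_poisson_ge0 (a : R) (j : int) : 0 < a -> (0 <= Msup (phi a) j)%E.
Proof.
move=> a0; apply: (@le_trans _ _ (expR (- (a * `|0 + 2 * pi * j%:~R|)))%:E).
  by rewrite lee_fin expR_ge0.
apply: ereal_sup_ubound; exists 0; first by rewrite /= normr0 pi_ge0.
by rewrite Re_fourier_poisson.
Qed.

Lemma Msup_poisson_le1 (a : R) (j : int) : 0 < a -> (Msup (phi a) j <= 1)%E.
Proof.
move=> a0; apply: ge_ereal_sup => _ [xi _ <-].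
by rewrite Re_fourier_poisson// lee_fin -[leRHS]expR0 ler_expR oppr_le0 mulr_ge0// ltW.
Qed.

(** For |xi| <= pi and |j| = n + 1 one has |xi + 2 pi j| >= pi + 2 pi n, so the transform is at most
    exp (- a pi) q^n with q = exp (- 2 pi a) <= 1/2. Writing 2^-n as 2 / 2^(n+1) matches the
    summands of [epsilon_trick0]. *)
Lemma Msup_poisson_le (a : R) (j : int) (n : nat) : 1 <= a -> `|j|%N = n.+1 ->
  (Msup (phi a) j <= (2 * expR (- (a * pi)) / (2 ^ n.+1)%:R)%:E)%E.
Proof.
move=> a1 jn; have a0 : 0 < a by exact: lt_le_trans a1.
have pi2 : 2 <= pi :> R := pi_ge2 R.
apply: ge_ereal_sup => _ [xi xipi <-]; rewrite Re_fourier_poisson// lee_fin.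
move: xipi => /= xipi.
have far : pi + 2 * pi * n%:R <= `|xi + 2 * pi * j%:~R|.
  have : `|2 * pi * j%:~R| = 2 * pi * (n%:R + 1) :> R.
    by rewrite normrM ger0_norm ?mulr_ge0 ?pi_ge0// -intr_norm -abszE jn natr1.
  have := ler_normB (xi + 2 * pi * j%:~R) xi.
  rewrite addrAC subrr add0r; lra.
(* This is where a >= 1 enters: exp (2 pi a) >= 1 + 2 pi a >= 2. *)
have q : expR (- (a * (2 * pi))) <= 2^-1.
  rewrite expRN lef_pV2 ?posrE ?expR_gt0//.
  rewrite (le_trans _ (expR_ge1Dx _))//; nra.
apply: (@le_trans _ _ (expR (- (a * pi)) * (2^-1) ^+ n)).
  apply: (@le_trans _ _ (expR (- (a * (pi + 2 * pi * n%:R))))).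
    by rewrite ler_expR lerN2 ler_pM2l.
  rewrite mulrDr opprD expRD ler_pM2l ?expR_gt0//.
  have -> : - (a * (2 * pi * n%:R)) = - (a * (2 * pi)) * n%:R by ring.
  by rewrite expRM_natr lerXn2r ?nnegrE ?expR_ge0 ?invr_ge0.
rewrite natrX exprS exprVn -[leRHS]mulrA (mulrCA 2) invfM mulVKf//.
Qed.

(** The positive integers, listed as [Posz n.+1], and the negative ones, listed as [Negz n], each
    have absolute value n + 1 at index n; each half is a geometric series with bound 2 exp (- a
    pi). *)
Lemma esum_Msup_poisson (a : R) : 1 <= a ->
  (\esum_(j in [set j : int | (j != 0)%R]) Msup (phi a) j
    <= (4 * expR (- (a * pi)))%:E)%E.
Proof.
move=> a1; have a0 : 0 < a by exact: lt_le_trans a1.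
have bound (e : nat -> int) : injective e -> (forall n, `|e n|%N = n.+1) ->
    (\esum_(j in [set e n | n in setT]) Msup (phi a) j
      <= (2 * expR (- (a * pi)))%:E)%E.
  move=> inje abse.
  rewrite esum_image; last by move=> x y _ _; exact: inje.
  rewrite -nneseries_esumT; last by move=> n; exact: Msup_poisson_ge0.
  apply: le_trans (epsilon_trick0 xpredT _); last by rewrite mulr_ge0// expR_ge0.
  by apply: lee_nneseries => n *; [exact: Msup_poisson_ge0|exact: Msup_poisson_le].
rewrite (esumID [set j : int | 0 < j]); last by move=> j _; exact: Msup_poisson_ge0.
rewrite (_ : (4 * _)%:E =
    (2 * expR (- (a * pi)))%:E + (2 * expR (- (a * pi)))%:E)%E; last first.
  by rewrite -EFinD; congr EFin; ring.
apply: leeD.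
- rewrite (_ : _ `&` _ = [set Posz n.+1 | n in setT]).
    by apply: bound => // m n [].
  apply/seteqP; split => [[[|n]|n] [//=]|_ [n _ <-]//].
  by exists n.
- rewrite (_ : _ `&` _ = [set Negz n | n in setT]).
    by apply: bound => // m n [].
  apply/seteqP; split => [[[|n]|n] [//=]|_ [n _ <-]//].
  by exists n.
Qed.

(** To the sum over nonzero j only the term j = 0 is added, which is at most 1. *)
Lemma condA3_poisson (a : R) : 1 <= a -> condA3 (phi a).
Proof.
move=> a1; have a0 : 0 < a by exact: lt_le_trans a1.
rewrite /condA3 /summable.
rewrite (eq_esum (b := Msup (phi a))); last first.
  by move=> j _; rewrite gee0_abs// Msup_poisson_ge0.
rewrite (esumID [set j : int | (j != 0)%R]); last by move=> j _; exact: Msup_poisson_ge0.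
rewrite setTI (_ : _ `&` _ = [set 0]); last first.
  by apply/seteqP; split => j /=; [move=> [_ /negP/negPn/eqP]|move=> ->; rewrite eqxx].
rewrite esum_set1 ?Msup_poisson_ge0//.
apply: (le_lt_trans (leeD (esum_Msup_poisson a1) (Msup_poisson_le1 0 a0))).
by rewrite -EFinD ltry.
Qed.

(** * The limit in (H3) and the regular family *)

(** For a >= 1 the ratio is exp (- (pi - |xi|) a), which decays because pi - |xi| > 0. *)
Lemma cvg_ratio_poisson (xi : R) : `|xi| < pi ->
  (fun a : R => minf (phi a) / complex.Re (fourier_real (phi a) xi))
    @ within [set a : R | 1 <= a] (pinfty_nbhs R) --> (0 : R).
Proof.
move=> xipi.
apply: cvg_trans (near_eq_cvg (f := fun a => expR (- ((pi - `|xi|) * a))) _) _.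
  rewrite near_withinE; apply: nearW => a a1.
  have a0 : 0 < a by exact: lt_le_trans a1.
  rewrite minf_poisson// Re_fourier_poisson// -expRN -expRD; congr expR; ring.
have p0 : 0 < pi - `|xi| by rewrite subr_gt0.
apply: cvg_trans (cvgy_expRN p0).
by apply: cvg_app; exact: cvg_within.
Qed.

End PoissonKernel.

Theorem proposition5 (R : realType) :
  regular_family_of_interpolators [set alpha : R | 1 <= alpha]
    (fun alpha x : R => Num.sqrt (2 / pi) * (alpha / (alpha ^+ 2 + x ^+ 2))).
Proof.
split.
- by move=> a /=; exact: lt_le_trans.
- move=> [M ub].
  have /ub : [set alpha : R | 1 <= alpha] (`|M| + 1) by rewrite /= lerDr.
  by rewrite leNgt ltr_pwDr// ler_norm.
- move=> a /= a1; have a0 : 0 < a by exact: lt_le_trans a1.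
  by split; [exact: condA1_poisson|exact: condA2_poisson|exact: condA3_poisson].
(* The minimum is exp (- a pi), exactly the factor in the bound on the sum. *)
- exists 4 => a /= a1; rewrite minf_poisson ?(lt_le_trans _ a1)//.
  exact: esum_Msup_poisson.
(* The exceptional null set consists of the two endpoints, where the ratio is constantly 1 on the
   index set. *)
- exists ([set pi] `|` [set - pi]); split.
  + by apply: measurableU; exact: measurable_set1.
  + apply: countable_lebesgue_measure0; apply: finite_set_countable.
    by rewrite finite_setU; split; exact: finite_set1.
  + move=> xi /= nP; apply: contrapT => h; apply: nP => xipi.
    apply: cvg_ratio_poisson; rewrite lt_neqAle xipi andbT; apply/eqP => e.
    by apply: h; case: (ger0P xi) e => _ e; [left|right]; rewrite -e// opprK.
Qed.
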